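(* Let $G$ be a simple connected undirected graph of order $n$ that is $r$-regular and $k$-resistance regular, and let $\rho_1(G)\ge\rho_2(G)\ge\cdots\ge\rho_n(G)$ be the eigenvalues, counted with multiplicity, of its resistance distance matrix. Then the eigenvalues, counted with multiplicity, of the resistance distance matrix of the lexicographic product $G[K_2]$ are: $\frac{\rho_1(G)}{2}+\frac{n}{r+1}$ (once); $\frac{\rho_i(G)}{2}$ (once for each $i=2,\dots,n$); and $-\frac{1}{r+1}$ ($n$ times).
   Context: For a connected graph $G$ with vertices $v_1,\dots,v_n$, Laplacian matrix $L$ (degree matrix minus adjacency matrix) and Moore-Penrose inverse $L^\dagger=(l^\dagger_{ij})$, the resistance distance is $r_{ij}=l^\dagger_{ii}+l^\dagger_{jj}-2l^\dagger_{ij}$, and the resistance distance matrix is $R(G)=(r_{ij})$. $G$ is $k$-resistance regular if every row sum of $R(G)$ equals $k$; it is $r$-regular if every vertex has degree $r$. The lexicographic product $G_1[G_2]$ has vertex set $V(G_1)\times V(G_2)$, with $(v_1,u_1)$ and $(v_2,u_2)$ adjacent if $v_1v_2\in E(G_1)$, or $v_1=v_2$ and $u_1u_2\in E(G_2)$. $K_2$ is the complete graph on 2 vertices. *)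

(* Defs.v *)
From HB Require Import structures.
From mathcomp Require Import all_boot all_order all_algebra.

Set Implicit Arguments.
Unset Strict Implicit.
Unset Printing Implicit Defensive.

Import Order.TTheory GRing.Theory Num.Theory.

Local Open Scope ring_scope.

Record sgraph := SGraph {
  vertex :> finType;
  edge : rel vertex;
  edge_sym : symmetric edge;
  edge_irrefl : irreflexive edge }.

Definition connected_graph (G : sgraph) : Prop :=
  (0 < #|G|)%N /\ forall x y : G, connect (@edge G) x y.

Definition deg (G : sgraph) (x : G) : nat := #|[pred y | edge x y]|.

Definition regular_graph (r : nat) (G : sgraph) : Prop :=
  forall x : G, deg x = r.

Definition complete_rel (n : nat) : rel 'I_n := fun i j => i != j.

Lemma complete_rel_sym n : symmetric (@complete_rel n).
Proof. by move=> i j; rewrite /complete_rel eq_sym. Qed.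

Lemma complete_rel_irrefl n : irreflexive (@complete_rel n).
Proof. by move=> i; rewrite /complete_rel eqxx. Qed.

Definition complete_graph (n : nat) : sgraph :=
  SGraph (@complete_rel_sym n) (@complete_rel_irrefl n).

Definition lex_rel (G H : sgraph) : rel (G * H) := fun p q =>
  edge p.1 q.1 || ((p.1 == q.1) && edge p.2 q.2).

Lemma lex_rel_sym G H : symmetric (@lex_rel G H).
Proof.
by move=> p q; rewrite /lex_rel edge_sym eq_sym (edge_sym p.2).
Qed.

Lemma lex_rel_irrefl G H : irreflexive (@lex_rel G H).
Proof. by move=> p; rewrite /lex_rel !edge_irrefl andbF. Qed.

Definition lex_prod (G H : sgraph) : sgraph :=
  SGraph (@lex_rel_sym G H) (@lex_rel_irrefl G H).

Definition is_moore_penrose (R : realFieldType) (m n : nat)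
    (A : 'M[R]_(m, n)) (X : 'M[R]_(n, m)) : Prop :=
  [/\ A *m X *m A = A, X *m A *m X = X,
      (A *m X)^T = A *m X & (X *m A)^T = X *m A].

(* From the full-rank factorization A = C F with C = col_base A and
   F = row_base A.  The library's pinvmx is only a generalized inverse. *)
Definition moore_penrose (R : realFieldType) (m n : nat)
    (A : 'M[R]_(m, n)) : 'M[R]_(n, m) :=
  let C := col_base A in let F := row_base A in
  F^T *m invmx (F *m F^T) *m invmx (C^T *m C) *m C^T.

Lemma gram_unitmx (R : realFieldType) (m n : nat) (F : 'M[R]_(m, n)) :
  row_free F -> F *m F^T \in unitmx.
Proof.
move=> Ffree; rewrite -row_free_unit -kermx_eq0; apply/eqP/row_matrixP => i.
rewrite row0; set v := row i _.
have v0 : v *m (F *m F^T) = 0 by rewrite /v -row_mul mulmx_ker row0.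
have w0 : (v *m F) *m (v *m F)^T = 0.
  by rewrite trmx_mul !mulmxA -(mulmxA v) v0 mul0mx.
apply: (row_free_inj Ffree); rewrite mul0mx; apply/rowP => j.
move/matrixP/(_ 0 0)/eqP: w0; rewrite !mxE.
under eq_bigr => k _ do rewrite [X in _ * X]mxE -expr2.
rewrite psumr_eq0 => [/allP/(_ j (mem_index_enum j))|k _]; last exact: sqr_ge0.
by rewrite sqrf_eq0 !mxE => /eqP.
Qed.

Lemma full_rank_moore_penrose (R : realFieldType) (m n p : nat)
    (C : 'M[R]_(m, p)) (F : 'M[R]_(p, n)) :
  C^T *m C \in unitmx -> F *m F^T \in unitmx ->
  is_moore_penrose (C *m F)
    (F^T *m invmx (F *m F^T) *m invmx (C^T *m C) *m C^T).
Proof.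
move=> CU FU; set X := _ *m C^T.
have AX : C *m F *m X = C *m invmx (C^T *m C) *m C^T.
  rewrite /X -!mulmxA (mulmxA F F^T) (mulmxA (F *m F^T)).
  by rewrite mulmxV // mul1mx.
have XA : X *m (C *m F) = F^T *m invmx (F *m F^T) *m F.
  rewrite /X -!mulmxA (mulmxA C^T C) (mulmxA (invmx (C^T *m C))).
  by rewrite mulVmx // mul1mx.
split.
- rewrite AX -!mulmxA (mulmxA C^T C) (mulmxA (invmx (C^T *m C))).
  by rewrite mulVmx // mul1mx.
- rewrite XA /X -!mulmxA (mulmxA F F^T) (mulmxA (F *m F^T)).
  by rewrite mulmxV // mul1mx.
- by rewrite AX !trmx_mul trmx_inv trmx_mul !trmxK mulmxA.
- by rewrite XA !trmx_mul trmx_inv trmx_mul !trmxK mulmxA.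
Qed.

Lemma moore_penroseP (R : realFieldType) (m n : nat) (A : 'M[R]_(m, n)) :
  is_moore_penrose A (moore_penrose A).
Proof.
have FU := gram_unitmx (row_base_free A).
have CU : (col_base A)^T *m col_base A \in unitmx.
  have /gram_unitmx : row_free (col_base A)^T.
    by rewrite /row_free mxrank_tr; exact: col_base_full.
  by rewrite trmxK.
by have := full_rank_moore_penrose CU FU; rewrite mulmx_base.
Qed.

Lemma moore_penrose_uniq (R : realFieldType) (m n : nat)
    (A : 'M[R]_(m, n)) (X Y : 'M[R]_(n, m)) :
  is_moore_penrose A X -> is_moore_penrose A Y -> X = Y.
Proof.
move=> [X1 X2 X3 X4] [Y1 Y2 Y3 Y4].
have AXY : A *m X = A *m Y.
  by rewrite -X3 -[in LHS]Y1 -mulmxA trmx_mul X3 Y3 mulmxA X1.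
have XYA : X *m A = Y *m A.
  by rewrite -X4 -[in LHS]Y1 -mulmxA mulmxA trmx_mul X4 Y4 -mulmxA (mulmxA A) X1.
by rewrite -X2 XYA -mulmxA AXY mulmxA Y2.
Qed.

(* Rows and columns are indexed by the positions in enum G, so that the
   vertex with index i is enum_val i. *)

Definition adjacency_mx (R : realFieldType) (G : sgraph) : 'M[R]_#|G| :=
  \matrix_(i, j) (edge (enum_val i) (enum_val j))%:R.

Definition degree_mx (R : realFieldType) (G : sgraph) : 'M[R]_#|G| :=
  diag_mx (\row_i (deg (enum_val i))%:R).

Definition laplacian_mx (R : realFieldType) (G : sgraph) : 'M[R]_#|G| :=
  degree_mx R G - adjacency_mx R G.

Definition resistance_mx (R : realFieldType) (G : sgraph) : 'M[R]_#|G| :=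
  let Ld := moore_penrose (laplacian_mx R G) in
  \matrix_(i, j) (Ld i i + Ld j j - 2 * Ld i j).

Definition resistance_regular (R : realFieldType) (k : R) (G : sgraph) : Prop :=
  forall i, \sum_j resistance_mx R G i j = k.

(* s lists all eigenvalues of A, repeated according to their algebraic
   multiplicity, in any order. *)
Definition eigenvalues_are (R : fieldType) (m : nat) (A : 'M[R]_m)
    (s : seq R) : Prop :=
  char_poly A = \prod_(x <- s) ('X - x%:P).

(* Main.v *)
Require Import Defs.
From HB Require Import structures.
From mathcomp Require Import all_boot all_order all_algebra.
From mathcomp Require Import perm ring.

Set Implicit Arguments.
Unset Strict Implicit.
Unset Printing Implicit Defensive.

Import Order.TTheory GRing.Theory Num.Theory.

Local Open Scope ring_scope.

(** Write [L], [R], [J] for the Laplacian of [G], its resistance matrix and the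
    all-ones matrix, and set [s = r + 1].  Listing the vertices of [G[K_2]] as
    two copies of [G], its Laplacian is the block matrix with diagonal blocks
    [L + s I] and off-diagonal blocks [L - s I] ([laplacian_layer]).  Matrices
    [twin_mx U V], with diagonal blocks [U + V] and off-diagonal blocks [U - V],
    multiply componentwise up to a factor 2, so the four Penrose equations are
    checked in each component and the Moore-Penrose inverse is
    [twin_mx (L^+ / 4) (I / (4 s))] ([moore_penrose_layer]).  Reading off
    resistances, the resistance matrix of [G[K_2]] is
    [twin_mx (R / 4 + J / (2 s)) (- I / (2 s))] ([resistance_layer]).

    The characteristic polynomial of [twin_mx U V] is the product of those of
    [2 U] and [2 V].  The second factor gives the eigenvalue [- 1 / s], [n]
    times.  The first is the characteristic polynomial of [R / 2 + J / s].  All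
    row sums of [R / 2] are [k / 2], so adding [J / s] only moves the eigenvalue
    [k / 2] of the all-ones vector to [k / 2 + n / s]
    ([char_poly_add_const_mx]).

    It remains to see that [k] is the first entry of the sorted list [rho]
    ([head_eigenvalue_resistance]).  As the Laplacian is positive semidefinite,
    so is its Moore-Penrose inverse, hence resistances are nonnegative, and no
    eigenvalue of a nonnegative matrix with constant column sums [k] exceeds
    [k]. *)

(** * Characteristic polynomials and spectra *)

Lemma det_mxsub_bij (R : comNzRingType) (m n : nat) (f : 'I_m -> 'I_n)
    (A : 'M[R]_n) :
  bijective f -> \det (mxsub f f A) = \det A.
Proof.
move=> bf; have := bij_eq_card bf; rewrite !card_ord => emn.
case: n / emn f A bf => f A /bij_inj f_inj.
have -> : mxsub f f A = row_perm (perm f_inj) (col_perm (perm f_inj) A).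
  by apply/matrixP=> i j; rewrite !mxE !permE.
rewrite row_permE col_permE !det_mulmx !det_perm mulrCA odd_permV -signr_addb addbb.
by rewrite mulr1.
Qed.

Lemma char_poly_mxsub (R : comNzRingType) (m n : nat) (f : 'I_m -> 'I_n)
    (A : 'M[R]_n) :
  bijective f -> char_poly (mxsub f f A) = char_poly A.
Proof.
move=> bf; rewrite /char_poly -(det_mxsub_bij _ bf); congr (\det _).
by apply/matrixP=> i j; rewrite !mxE (inj_eq (bij_inj bf)).
Qed.

Lemma det_block_swap (R : comNzRingType) (m : nat) (S D : 'M[R]_m) :
  \det (block_mx S D D S) = \det (S + D) * \det (S - D).
Proof.
have detl : \det (block_mx 1%:M 0 (- 1%:M) 1%:M : 'M[R]_(m + m)) = 1.
  by rewrite det_lblock !det1 mulr1.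
have detr : \det (block_mx 1%:M 0 1%:M 1%:M : 'M[R]_(m + m)) = 1.
  by rewrite det_lblock !det1 mulr1.
rewrite -[LHS]mul1r -detl -[LHS]mulr1 -[X in _ * X]detr -!det_mulmx.
rewrite !mulmx_block !(mul1mx, mul0mx, mulmx1, mulmx0, mulNmx, addr0, add0r).
have -> : - S + D + (- D + S) = 0 by rewrite addrA addrK addNr.
by rewrite det_ublock [- D + S]addrC det_mulmx.
Qed.

Lemma char_poly_block_swap (R : comNzRingType) (m : nat) (S D : 'M[R]_m) :
  char_poly (block_mx S D D S) = char_poly (S + D) * char_poly (S - D).
Proof.
rewrite /char_poly /char_poly_mx map_block_mx (scalar_mx_block m m 'X).
rewrite opp_block_mx add_block_mx !add0r det_block_swap.
by congr (_ * _); congr (\det _); apply/matrixP=> i j;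
  rewrite !mxE ?polyCB ?polyCD; ring.
Qed.

(** If all rows of [B] sum to [y], then in a basis starting with the all-ones
    vector [B] is block triangular with upper left entry [y]; the other diagonal
    block is unchanged when a constant matrix is added to [B]. *)
Lemma det_row_sum (R : comNzRingType) (m : nat) (B : 'M[R]_(1 + m)) (y : R) :
  B *m const_mx 1 = const_mx y :> 'cV_(1 + m) ->
  \det B = y * \det (drsubmx B - const_mx 1 *m ursubmx B).
Proof.
rewrite -{1}(submxK B) -!col_mx_const mul_block_col => /eq_col_mx [eu ed].
set Q : 'M[R]_(1 + m) := block_mx 1%:M 0 (- const_mx 1) 1%:M.
set P : 'M[R]_(1 + m) := block_mx 1%:M 0 (const_mx 1) 1%:M.
have detQ : \det Q = 1 by rewrite det_lblock !det1 mulr1.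
have detP : \det P = 1 by rewrite det_lblock !det1 mulr1.
have c1 : const_mx 1 = 1%:M :> 'M[R]_1 by apply/matrixP=> i j; rewrite !mxE !ord1.
move: eu ed; rewrite c1 !mulmx1 => eu ed.
(* P puts the all-ones vector first in the basis, and Q is its inverse. *)
have -> : \det B = \det (Q *m (B *m P)).
  by rewrite !det_mulmx detQ detP mul1r mulr1.
rewrite -[in LHS](submxK B) !mulmx_block.
rewrite !(mul1mx, mul0mx, mulmx1, mulmx0, mulNmx, addr0, add0r) eu ed.
have -> : (const_mx 1 : 'cV_m) *m (const_mx y : 'M_1) = const_mx y.
  by apply/matrixP=> i j; rewrite !mxE big_ord1 !mxE mul1r.
by rewrite addNr det_ublock det_mx11 mxE [- _ + _]addrC.
Qed.

(** Cross-multiplied so that it holds over any commutative ring, in particular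
    over polynomials, where [y] need not be invertible. *)
Lemma det_add_const_mx (R : comNzRingType) (m : nat) (B : 'M[R]_m) (y c : R) :
  B *m const_mx 1 = const_mx y :> 'cV_m ->
  \det (B + const_mx c) * y = \det B * (y + c *+ m).
Proof.
case: m B => [|m] B; first by rewrite !det_mx00 addr0.
move: B; rewrite -[m.+1]/(1 + m)%N => B hB.
have hBc : (B + const_mx c) *m const_mx 1 = const_mx (y + c *+ (1 + m))
    :> 'cV_(1 + m).
  rewrite mulmxDl hB; apply/matrixP=> i j; rewrite !mxE.
  under eq_bigr do rewrite !mxE mulr1.
  by rewrite sumr_const card_ord.
rewrite (det_row_sum hB) (det_row_sum hBc).
have -> : drsubmx (B + const_mx c) - const_mx 1 *m ursubmx (B + const_mx c)
    = drsubmx B - const_mx 1 *m ursubmx B.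
  by apply/matrixP=> i j; rewrite !mxE !big_ord1 !mxE; ring.
by ring.
Qed.

Lemma char_poly_add_const_mx (R : comNzRingType) (m : nat) (M : 'M[R]_m)
    (k c : R) :
  (forall i, \sum_j M i j = k) ->
  char_poly (M + const_mx c) * ('X - k%:P)
    = char_poly M * ('X - (k + c *+ m)%:P).
Proof.
move=> hM; have hB : char_poly_mx M *m const_mx 1 = const_mx ('X - k%:P)
    :> 'cV_m.
  apply/matrixP=> i j; rewrite !mxE.
  under eq_bigr => l _ do rewrite !mxE mulr1.
  rewrite sumrB -rmorph_sum hM (bigD1 i) //= eqxx big1 ?addr0 // => l.
  by rewrite eq_sym => /negbTE ->.
have := det_add_const_mx (- c%:P) hB.
have -> : 'X - k%:P + - c%:P *+ m = 'X - (k + c *+ m)%:P.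
  by rewrite polyCD polyCMn mulNrn opprD addrA.
move=> <-; congr (_ * _); congr (\det _).
by apply/matrixP=> i j; rewrite !mxE polyCD; ring.
Qed.

Lemma eigenvalues_are_scale (F : fieldType) (m : nat) (M : 'M[F]_m) (a : F)
    (s : seq F) :
  a != 0 -> eigenvalues_are M s -> eigenvalues_are (a *: M) [seq a * x | x <- s].
Proof.
rewrite /eigenvalues_are => a0 hM.
have sz : size s = m.
  by have := size_char_poly M; rewrite hM size_prod_XsubC => -[].
have -> : char_poly (a *: M) = a%:P ^+ m * (char_poly M \Po (a^-1 *: 'X)).
  rewrite /char_poly -[_ \Po _]/(comp_poly (a^-1 *: 'X) _) -det_map_mx -detZ.
  (* X I - a M is a times X I - M evaluated at X / a. *)
  congr (\det _); apply/matrixP=> i j; rewrite !mxE rmorphB rmorphMn /=.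
  rewrite comp_polyX comp_polyC mulrBr mulrnAr -mul_polyC mulrA -!polyCM.
  by rewrite divff // mul1r.
rewrite hM -[_ \Po _]/(comp_poly (a^-1 *: 'X) _) rmorph_prod big_map.
rewrite -sz -[X in _ ^+ X]count_predT -[X in X * _]mulr1 -iter_mulr.
rewrite -big_const_seq -big_split /=; apply: eq_bigr => x _.
rewrite rmorphB /= comp_polyX comp_polyC mulrBr -mul_polyC mulrA -!polyCM.
by rewrite divff // mul1r.
Qed.

(** The easy half of the Perron-Frobenius bound. *)
Lemma eigenvalue_le_col_sum (R : realFieldType) (m : nat) (M : 'M[R]_m)
    (k a : R) :
  (forall i j, 0 <= M i j) -> (forall j, \sum_i M i j = k) ->
  eigenvalue M a -> a <= k.
Proof.
move=> M0 hM /eigenvalueP[v hv v0].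
(* Compare both sides of v M = a v at an entry of v of largest norm. *)
have [j0 vj0] : exists j, v 0 j != 0.
  by apply/existsP; apply: contra_neqT v0 => /existsPn v0; apply/rowP=> j;
    rewrite mxE; apply/eqP; have := v0 j; rewrite negbK.
pose j := [arg max_(i > j0) `|v 0 i|]%O.
have vj i : `|v 0 i| <= `|v 0 j|.
  by rewrite /j; case: arg_maxP => // l _; apply.
have vj_gt0 : 0 < `|v 0 j| by apply: lt_le_trans (vj j0); rewrite normr_gt0.
rewrite -(ler_pM2r vj_gt0); apply: le_trans (_ : `|a * v 0 j| <= _).
  by rewrite normrM ler_pM2r // ler_norm.
have -> : a * v 0 j = \sum_i v 0 i * M i j.
  by have /rowP/(_ j) := hv; rewrite !mxE.
apply: le_trans (ler_norm_sum _ _ _) _; rewrite -(hM j) mulr_suml.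
apply: ler_sum => i _; rewrite normrM (ger0_norm (M0 i j)) mulrC.
by rewrite ler_wpM2l.
Qed.

(** * Laplacians, Moore-Penrose inverses and resistances *)

Lemma is_moore_penrose_tr (R : realFieldType) (m n : nat)
    (A : 'M[R]_(m, n)) (X : 'M[R]_(n, m)) :
  is_moore_penrose A X -> is_moore_penrose A^T X^T.
Proof.
by case=> [h1 h2 h3 h4]; split; rewrite -?trmx_mul ?mulmxA ?h1 ?h2 ?h3 ?h4.
Qed.

Lemma moore_penrose_sym (R : realFieldType) (m : nat) (A : 'M[R]_m) :
  A^T = A -> (moore_penrose A)^T = moore_penrose A.
Proof.
move=> hA; apply: moore_penrose_uniq (moore_penroseP A).
by rewrite -{1}hA; apply/is_moore_penrose_tr/moore_penroseP.
Qed.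

Lemma mulmx_mxsub_bij (R : comNzRingType) (m n : nat) (f : 'I_m -> 'I_n)
    (A B : 'M[R]_n) :
  bijective f -> mxsub f f (A *m B) = mxsub f f A *m mxsub f f B.
Proof.
move=> bf; apply/matrixP=> i j; rewrite !mxE (reindex f) /=.
  by apply: eq_bigr => l _; rewrite !mxE.
exact: onW_bij.
Qed.

Lemma is_moore_penrose_mxsub (R : realFieldType) (m n : nat)
    (f : 'I_m -> 'I_n) (A X : 'M[R]_n) :
  bijective f -> is_moore_penrose A X ->
  is_moore_penrose (mxsub f f A) (mxsub f f X).
Proof.
move=> bf [h1 h2 h3 h4].
by split; rewrite -!mulmx_mxsub_bij ?h1 ?h2 // trmx_mxsub ?h3 ?h4.
Qed.

Section Graph.
Variables (R : realFieldType) (G : sgraph).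
Local Notation L := (laplacian_mx R G).

Lemma adjacency_row_sum i :
  \sum_j adjacency_mx R G i j = (deg (enum_val i))%:R.
Proof.
under eq_bigr do rewrite mxE.
rewrite -(big_enum_val (fun y => (edge (enum_val i) y)%:R)) /deg -sum1_card.
by rewrite natr_sum big_mkcond /= [RHS]big_mkcond; apply: eq_bigr => y _;
  rewrite !inE; case: (edge _ _).
Qed.

Lemma laplacian_mxE i j :
  L i j = (deg (enum_val i))%:R *+ (i == j) - adjacency_mx R G i j.
Proof. by rewrite !mxE. Qed.

Lemma adjacency_sym i j : adjacency_mx R G i j = adjacency_mx R G j i.
Proof. by rewrite !mxE edge_sym. Qed.

Lemma laplacian_tr : L^T = L.
Proof.
apply/matrixP=> i j; rewrite mxE !laplacian_mxE adjacency_sym eq_sym.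
by case: eqP => [->|].
Qed.

(** The quadratic form of the Laplacian is half the sum of [(x_i - x_j)^2] over
    ordered pairs of adjacent vertices. *)
Lemma laplacian_psd (x : 'rV[R]_#|G|) : 0 <= (x *m L *m x^T) 0 0.
Proof.
pose a := adjacency_mx R G.
have -> : (x *m L *m x^T) 0 0
    = 2^-1 * \sum_i \sum_j a i j * (x 0 i - x 0 j) ^+ 2.
  have -> : (x *m L *m x^T) 0 0 =
     \sum_i \sum_j a i j * x 0 i ^+ 2 - \sum_i \sum_j a i j * (x 0 i * x 0 j).
    rewrite -sumrB !mxE.
    transitivity (\sum_j \sum_i x 0 i * L i j * x 0 j).
      by apply: eq_bigr => j _; rewrite !mxE mulr_suml.
    rewrite exchange_big; apply: eq_bigr => i _ /=.
    rewrite -mulr_suml adjacency_row_sum.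
    under eq_bigr do rewrite laplacian_mxE mulrBr mulrBl.
    rewrite sumrB (bigD1 i) //= eqxx big1 => [|j]; last first.
      by rewrite eq_sym => /negbTE ->; rewrite mulr0 mul0r.
    rewrite addr0 mulr1n; congr (_ - _); first by ring.
    by apply: eq_bigr => j _; rewrite /a; ring.
  have e : \sum_i \sum_j a i j * x 0 j ^+ 2 = \sum_i \sum_j a i j * x 0 i ^+ 2.
    rewrite exchange_big; apply: eq_bigr => i _; apply: eq_bigr => j _.
    by rewrite /a adjacency_sym.
  transitivity (2^-1 * (\sum_i \sum_j a i j * x 0 i ^+ 2
     + \sum_i \sum_j a i j * x 0 j ^+ 2
     - 2 * \sum_i \sum_j a i j * (x 0 i * x 0 j))); first by rewrite e; field.
  congr (_ * _); rewrite mulr_sumr -big_split -sumrB; apply: eq_bigr => i _ /=.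
  rewrite mulr_sumr -big_split -sumrB; apply: eq_bigr => j _ /=; ring.
rewrite mulr_ge0 ?invr_ge0 ?ler0n //; apply: sumr_ge0 => i _.
apply: sumr_ge0 => j _.
by rewrite mulr_ge0 ?sqr_ge0 // mxE ler0n.
Qed.

Local Notation X := (moore_penrose L).

(** With [X] the inverse, [X = X L X] and [X] is symmetric, so the form of [X] at
    [w] is that of [L] at [w X]. *)
Lemma moore_penrose_laplacian_psd (w : 'rV[R]_#|G|) :
  0 <= (w *m X *m w^T) 0 0.
Proof.
have [_ <- _ _] := moore_penroseP L.
have := laplacian_psd (w *m X).
by rewrite trmx_mul (moore_penrose_sym laplacian_tr) !mulmxA.
Qed.

Lemma resistance_ge0 i j : 0 <= resistance_mx R G i j.
Proof.
(* The resistance is the value of the form of the inverse at e_i - e_j. *)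
have := moore_penrose_laplacian_psd (delta_mx 0 i - delta_mx 0 j).
have -> : (delta_mx 0 i - delta_mx 0 j : 'rV[R]_#|G|)^T
   = delta_mx i 0 - delta_mx j 0.
  by apply/matrixP=> l o; rewrite !mxE !ord1 !eqxx !andbT.
rewrite mulmxBl mulmxBr -!rowE -!colE.
rewrite [resistance_mx R G i j]mxE.
move: (moore_penrose_sym laplacian_tr); move: X => Y Ysym.
have Yji : Y j i = Y i j by rewrite -{1}Ysym mxE.
by rewrite !mxE Yji; congr (0 <= _); ring.
Qed.

Lemma resistance_sym i j : resistance_mx R G i j = resistance_mx R G j i.
Proof.
rewrite [LHS]mxE [RHS]mxE.
move: (moore_penrose_sym laplacian_tr); move: X => Y Ysym.
have Yji : Y j i = Y i j by rewrite -{1}Ysym mxE.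
by rewrite Yji; ring.
Qed.

Lemma resistance_eigenvalue_le (k a : R) :
  resistance_regular k G -> eigenvalue (resistance_mx R G) a -> a <= k.
Proof.
move=> hk; apply: eigenvalue_le_col_sum; first exact: resistance_ge0.
by move=> j; rewrite -(hk j); apply: eq_bigr => i _; rewrite resistance_sym.
Qed.

Lemma resistance_eigenvalue (k : R) :
  (0 < #|G|)%N -> resistance_regular k G -> eigenvalue (resistance_mx R G) k.
Proof.
move=> G0 hk; apply/eigenvalueP; exists (const_mx 1).
  apply/rowP=> j; rewrite !mxE mulr1 -(hk j); apply: eq_bigr => i _.
  by rewrite [const_mx _ _ _]mxE mul1r resistance_sym.
by apply/eqP => /rowP/(_ (Ordinal G0))/eqP; rewrite !mxE oner_eq0.
Qed.

Lemma head_eigenvalue_resistance (k : R) (rho : seq R) :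
  (0 < #|G|)%N -> resistance_regular k G -> sorted >=%R rho ->
  eigenvalues_are (resistance_mx R G) rho -> rho`_0 = k.
Proof.
move=> G0 hk hsort hrho.
have root_rho x : eigenvalue (resistance_mx R G) x = (x \in rho).
  by rewrite eigenvalue_root_char hrho root_prod_XsubC.
have krho : k \in rho by rewrite -root_rho resistance_eigenvalue.
have rho_le x : x \in rho -> x <= k.
  by rewrite -root_rho; apply: resistance_eigenvalue_le.
case: rho hsort krho rho_le {hrho root_rho} => // x s /= hsort krho rho_le.
apply/le_anti; rewrite rho_le ?mem_head //=.
move: krho; rewrite inE => /predU1P[-> //|ks].
have /allP := order_path_min (rev_trans le_trans) hsort.
by move/(_ k ks).
Qed.

End Graph.

(** * The lexicographic product with an edge *)

Section LexK2.
Variables (R : realFieldType) (G : sgraph).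
Local Notation H := (lex_prod G (complete_graph 2)).
Local Notation n := #|G|.

(** The vertices of [G[K_2]] listed layer by layer: position [i < n] is the copy
    of vertex [i] of [G] in layer 0, and position [n + i] its copy in layer 1. *)
Definition layer_index (p : 'I_(n + n)) : 'I_#|H| :=
  enum_rank (match split p with
             | inl i => (enum_val i, ord0)
             | inr i => (enum_val i, ord_max)
             end : H).

Lemma layer_index_bij : bijective layer_index.
Proof.
apply: inj_card_bij; last first.
  by rewrite !card_ord card_prod card_ord muln2 addnn.
move=> p q /enum_rank_inj.
case: (splitP p) => i hi; case: (splitP q) => j hj // [/enum_val_inj eij];
  by apply: val_inj; rewrite /= hi hj eij.
Qed.

Lemma layer_lshift i :
  enum_val (layer_index (lshift n i)) = (enum_val i, ord0).
Proof. by rewrite enum_rankK (unsplitK (inl i)). Qed.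

Lemma layer_rshift i :
  enum_val (layer_index (rshift n i)) = (enum_val i, ord_max).
Proof. by rewrite enum_rankK (unsplitK (inr i)). Qed.

Lemma adjacency_layer :
  mxsub layer_index layer_index (adjacency_mx R H) =
  block_mx (adjacency_mx R G) (adjacency_mx R G + 1%:M)
           (adjacency_mx R G + 1%:M) (adjacency_mx R G).
Proof.
have eE (i j : 'I_n) (a b : 'I_2) :
    (@edge H (enum_val i, a) (enum_val j, b))%:R
    = (adjacency_mx R G i j + (i == j)%:R *+ (a != b)).
  rewrite mxE -[@edge H _ _]/(edge (enum_val i) (enum_val j)
                              || (enum_val i == enum_val j) && (a != b)).
  rewrite (inj_eq enum_val_inj).
  have [->|] := eqVneq i j; last by rewrite orbF mul0rn addr0.
  by rewrite edge_irrefl add0r; case: (a != b).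
rewrite -[LHS]submxK; congr block_mx; apply/matrixP=> i j;
  rewrite 4!mxE ?layer_lshift ?layer_rshift eE.
- by rewrite addr0.
- by rewrite !mxE.
- by rewrite !mxE.
- by rewrite addr0.
Qed.

Variable r : nat.
Hypothesis Greg : regular_graph r G.

Lemma laplacian_regular : laplacian_mx R G = r%:R%:M - adjacency_mx R G.
Proof.
by apply/matrixP=> i j; rewrite laplacian_mxE Greg !mxE.
Qed.

(** Every vertex of [G[K_2]] has degree [2 r + 1]. *)
Lemma deg_layer p : (deg (enum_val (layer_index p)))%:R = 2 * r%:R + 1 :> R.
Proof.
rewrite -adjacency_row_sum (reindex layer_index) /=; last first.
  exact: onW_bij layer_index_bij.
transitivity (\sum_q (mxsub layer_index layer_index (adjacency_mx R H)) p q).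
  by apply: eq_bigr => q _; rewrite [RHS]mxE.
have rowA i : \sum_j adjacency_mx R G i j = r%:R by rewrite adjacency_row_sum Greg.
have rowA1 i : \sum_j (adjacency_mx R G + 1%:M) i j = r%:R + 1.
  under eq_bigr do rewrite mxE; rewrite big_split /= rowA; congr (_ + _).
  rewrite (bigD1 i) //= big1 => [|j]; first by rewrite mxE eqxx addr0.
  by rewrite mxE eq_sym => /negbTE ->.
rewrite adjacency_layer big_split_ord /=; case: (split_ordP p) => i ->.
- under eq_bigr do rewrite block_mxEul.
  under [X in _ + X]eq_bigr do rewrite block_mxEur.
  by rewrite rowA rowA1; ring.
- under eq_bigr do rewrite block_mxEdl.
  under [X in _ + X]eq_bigr do rewrite block_mxEdr.
  by rewrite rowA rowA1; ring.
Qed.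

(** The block form of [U (x) J + V (x) (2 I - J)], where (x) is the Kronecker
    product and [I], [J] are the 2 by 2 identity and all-ones matrices.  Since
    [J / 2] and [I - J / 2] are complementary orthogonal projections, [2 U] and
    [2 V] are the actions of the matrix on the vectors symmetric, respectively
    antisymmetric, under the exchange of layers. *)
Definition twin_mx (U V : 'M[R]_n) : 'M[R]_(n + n) :=
  block_mx (U + V) (U - V) (U - V) (U + V).

Lemma mul_twin_mx U V U' V' :
  twin_mx U V *m twin_mx U' V' = twin_mx (2 *: (U *m U')) (2 *: (V *m V')).
Proof.
rewrite /twin_mx mulmx_block; congr block_mx;
  rewrite !(mulmxBl, mulmxBr, mulmxDl, mulmxDr, mulNmx, mulmxN);
  move: (U *m U') (U *m V') (V *m U') (V *m V') => a b c d;
  by apply/matrixP=> i j; rewrite !mxE; ring.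
Qed.

Lemma tr_twin_mx U V : (twin_mx U V)^T = twin_mx U^T V^T.
Proof. by rewrite /twin_mx tr_block_mx !(linearB, linearD). Qed.

Lemma char_poly_twin_mx U V :
  char_poly (twin_mx U V) = char_poly (2 *: U) * char_poly (2 *: V).
Proof.
rewrite char_poly_block_swap; congr (_ * _); congr char_poly;
  by apply/matrixP=> i j; rewrite !mxE; ring.
Qed.

Local Notation f := layer_index.
Local Notation s := (r%:R + 1 : R).
Local Notation L := (laplacian_mx R G).
Local Notation X := (moore_penrose L).

Lemma succ_regularity_neq0 : s != 0.
Proof. by rewrite natr1 pnatr_eq0. Qed.

Lemma laplacian_layer : mxsub f f (laplacian_mx R H) = twin_mx L s%:M.
Proof.
have -> : mxsub f f (laplacian_mx R H)
    = (2 * r%:R + 1)%:M - mxsub f f (adjacency_mx R H).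
  apply/matrixP=> p q.
  rewrite mxE laplacian_mxE deg_layer (inj_eq (bij_inj layer_index_bij)).
  by rewrite !mxE.
rewrite adjacency_layer (scalar_mx_block n n) opp_block_mx add_block_mx.
rewrite laplacian_regular; congr block_mx;
  apply/matrixP=> i j; move: (adjacency_mx R G) => A; rewrite !mxE; ring.
Qed.

Lemma moore_penrose_layer :
  mxsub f f (moore_penrose (laplacian_mx R H))
  = twin_mx (4^-1 *: X) ((4 * s)^-1)%:M.
Proof.
have s0 := succ_regularity_neq0.
apply: (moore_penrose_uniq (A := mxsub f f (laplacian_mx R H))).
  exact: is_moore_penrose_mxsub layer_index_bij (moore_penroseP _).
have [h1 h2 h3 h4] := moore_penroseP L.
rewrite laplacian_layer; move: X h1 h2 h3 h4 => Y h1 h2 h3 h4.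
have LY : twin_mx L s%:M *m twin_mx (4^-1 *: Y) ((4 * s)^-1)%:M
    = twin_mx (2^-1 *: (L *m Y)) 2^-1%:M.
  rewrite mul_twin_mx -scalemxAr scalerA -scalar_mxM scale_scalar_mx.
  by congr (twin_mx (_ *: _) _%:M); field.
have YL : twin_mx (4^-1 *: Y) ((4 * s)^-1)%:M *m twin_mx L s%:M
    = twin_mx (2^-1 *: (Y *m L)) 2^-1%:M.
  rewrite mul_twin_mx -scalemxAl scalerA -scalar_mxM scale_scalar_mx.
  by congr (twin_mx (_ *: _) _%:M); field.
split.
- rewrite LY mul_twin_mx -scalemxAl h1 scalerA -scalar_mxM scale_scalar_mx.
  by rewrite mulrA divff ?pnatr_eq0 // scale1r mul1r.
- rewrite YL mul_twin_mx -scalemxAl -scalemxAr h2 !scalerA -scalar_mxM.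
  by rewrite scale_scalar_mx !mulrA divff ?pnatr_eq0 // !mul1r.
- by rewrite LY tr_twin_mx linearZ /= h3 tr_scalar_mx.
- by rewrite YL tr_twin_mx linearZ /= h4 tr_scalar_mx.
Qed.

Lemma resistance_layer :
  mxsub f f (resistance_mx R H)
  = twin_mx (4^-1 *: resistance_mx R G + const_mx ((2 * s)^-1))
            (- (2 * s)^-1)%:M.
Proof.
have s0 := succ_regularity_neq0.
have Xf p q : moore_penrose (laplacian_mx R H) (f p) (f q)
    = twin_mx (4^-1 *: X) ((4 * s)^-1)%:M p q.
  by rewrite -moore_penrose_layer [RHS]mxE.
have RG i j : resistance_mx R G i j = X i i + X j j - 2 * X i j by rewrite mxE.
apply/matrixP=> p q; rewrite mxE [LHS]mxE !Xf.
case: (split_ordP p) => i ->; case: (split_ordP q) => j ->;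
  rewrite ?block_mxEul ?block_mxEur ?block_mxEdl ?block_mxEdr;
  move: X (resistance_mx R G) RG => Y A RG;
  rewrite !(mxE, RG) !eqxx; case: eqP => [->|_];
  by rewrite ?mulr1n ?mulr0n; field.
Qed.

Lemma char_poly_resistance_lexK2 :
  char_poly (resistance_mx R H)
  = char_poly (2^-1 *: resistance_mx R G + const_mx s^-1)
    * \prod_(x <- nseq n (- (1 / s))) ('X - x%:P).
Proof.
have s0 := succ_regularity_neq0.
rewrite -(char_poly_mxsub _ layer_index_bij) resistance_layer char_poly_twin_mx.
congr (_ * _).
  congr char_poly; apply/matrixP=> i j; move: (resistance_mx R G) => A.
  by rewrite !mxE; field.
rewrite scale_scalar_mx /char_poly /char_poly_mx map_scalar_mx -raddfB det_scalar.
rewrite big_nseq iter_mulr mulr1; congr ((_ - _%:P) ^+ _); by field.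
Qed.

End LexK2.

Theorem theorem5p2 (R : rcfType) (G : sgraph) (n r : nat) (k : R)
    (rho : n.-tuple R)
    (hconn : connected_graph G)
    (hn : #|G| = n)
    (hreg : regular_graph r G)
    (hres : resistance_regular k G)
    (hsort : sorted >=%R rho)
    (hrho : eigenvalues_are (resistance_mx R G) rho) :
  eigenvalues_are (resistance_mx R (lex_prod G (complete_graph 2)))
    ([:: rho`_0 / 2 + n%:R / (r%:R + 1)]
       ++ [seq rho`_i / 2 | i <- iota 1 n.-1]
       ++ nseq n (- (1 / (r%:R + 1)))).
Proof.
case: hconn => G0 _; subst n.
have rho0 := head_eigenvalue_resistance G0 hres hsort hrho.
rewrite /eigenvalues_are (char_poly_resistance_lexK2 R hreg) big_cat big_seq1.
rewrite big_cat /= mulrA; congr (_ * _).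
have hsum i : \sum_j (2^-1 *: resistance_mx R G) i j = k / 2.
  under eq_bigr do rewrite mxE.
  by rewrite -mulr_sumr hres mulrC.
have rho_half : [seq 2^-1 * x | x <- rho]
    = k / 2 :: [seq rho`_i / 2 | i <- iota 1 #|G|.-1].
  rewrite -rho0 -[_ :: _]/[seq rho`_i / 2 | i <- iota 0 #|G|.-1.+1] prednK //.
  rewrite -[in LHS](mkseq_nth 0 rho) size_tuple -map_comp.
  by apply: eq_map => i /=; rewrite mulrC.
have half0 : 2^-1 != 0 :> R by rewrite invr_eq0 pnatr_eq0.
have k0 : 'X - (k / 2)%:P != 0 by rewrite polyXsubC_eq0.
(* The factor X - k / 2 of the characteristic polynomial of R / 2 is the one
   replaced by X - (k / 2 + n / s), so it is put back to compare the two. *)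
apply: (mulIf k0); rewrite (char_poly_add_const_mx _ hsum).
rewrite (eigenvalues_are_scale half0 hrho) rho_half big_cons rho0.
rewrite -[_^-1 *+ _]mulr_natl.
by rewrite [LHS]mulrC [RHS]mulrC mulrCA.
Qed.
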